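(* Let $P=\sum_{i=0}^m A_i(x)\frac{d^i}{dx^i}$ with $A_i\in M_N(\mathbb{C}[x])$ and $\det A_m(x)\not\equiv 0$, and let $l(k)$, $d(k)$, $n'$ be as defined in the context. If $l(k)\not\equiv0$ and $d(k)\not\equiv 0$, then $$\chi(P;\mathbb{C}[x]^N)=Nn'=N\inf_{0\le i\le m}(i-\deg A_i).$$
   Context: Write $A_i(x)=A_i^0+A_i^1x+\dots+A_i^{d_i}x^{d_i}$ with constant $N\times N$ complex matrices $A_i^j$, where $d_i=\deg A_i$ is the supremum of the degrees of the entries of $A_i$ ($d_i=-\infty$ if $A_i\equiv 0$). Put $n_i=\inf\{j: A_i^j\ne0\}$ (with $n_i=+\infty$ if $A_i\equiv 0$), $n=\sup_{0\le i\le m}(i-n_i)$, $J=\{j: j-n_j=n\}$, $L(k)=\sum_{j\in J}k(k-1)\cdots(k-j+1)A_j^{n_j}$, $l(k)=\det L(k)$. Put $n'=\inf_{0\le i\le m}(i-d_i)$, $J'=\{j: j-d_j=n'\}$, $D(k)=\sum_{j\in J'}k(k-1)\cdots(k-j+1)A_j^{d_j}$, $d(k)=\det D(k)$. Both $l$ and $d$ are polynomials in $k$. For a linear map $u:E\to E$ of a $\mathbb{C}$-vector space with $\dim\ker u$ and $\dim\mathrm{Coker}\,u$ finite, $u$ is said to have an index, and $\chi(u;E)=\dim\ker u-\dim\mathrm{Coker}\,u$. The operator $P$ acts on $\mathbb{C}[x]^N$ (column vectors). *)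

(* Defs.v *)
From HB Require Import structures.
From mathcomp Require Import all_boot all_order all_algebra.
From mathcomp Require Import generic_quotient ring_quotient.
From mathcomp Require Import boolp constructive_ereal.

Set Implicit Arguments.
Unset Strict Implicit.
Unset Printing Implicit Defensive.

Import Order.TTheory GRing.Theory Num.Theory.
Local Open Scope ring_scope.
Local Open Scope quotient_scope.

Section Index.
Variables (K : fieldType) (E : lmodType K).
Implicit Type u : {linear E -> E}.

Definition ker_pred u : {pred E} := fun v => u v == 0.

Lemma ker_pred_submod u : submod_closed (ker_pred u).
Proof.
split; first by rewrite unfold_in raddf0.
by move=> a v w; rewrite !unfold_in linearP => /eqP-> /eqP->; rewrite scaler0 addr0.
Qed.

HB.instance Definition _ u :=
  GRing.isSubmodClosed.Build K E (ker_pred u)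
    (GRing.subsemimod_closed_submod (ker_pred_submod u)).

Record ker u := Ker { ker_val : E; _ : ker_val \in ker_pred u }.

HB.instance Definition _ u := [isSub for @ker_val u].
HB.instance Definition _ u := [Choice of ker u by <:].
HB.instance Definition _ u := [SubChoice_isSubLmodule of ker u by <:].

Definition range_pred u : {pred E} := fun w => `[< exists v, u v = w >].

Lemma range_predP u w : reflect (exists v, u v = w) (w \in range_pred u).
Proof. exact: asboolP. Qed.

Lemma range_pred_zmod u : zmod_closed (range_pred u).
Proof.
split; first by apply/range_predP; exists 0; rewrite raddf0.
move=> _ _ /range_predP[v <-] /range_predP[w <-].
by apply/range_predP; exists (v - w); rewrite raddfB.
Qed.

HB.instance Definition _ u :=
  GRing.isZmodClosed.Build E (range_pred u) (range_pred_zmod u).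

Definition coker u := Quotient.quot (range_pred u).

HB.instance Definition _ u := GRing.Zmodule.on (coker u).

Lemma coker_reprK u (x : coker u) : \pi_(coker u) (repr x) = x.
Proof. exact: reprK. Qed.

Definition coker_scale u (a : K) (x : coker u) : coker u :=
  \pi_(coker u) (a *: repr x).

Lemma coker_pi_eq u (v w : E) :
  (\pi_(coker u) v == \pi_(coker u) w) = (v - w \in range_pred u).
Proof. by rewrite -Quotient.idealrBE. Qed.

Lemma coker_pi_scale u a (v : E) :
  coker_scale a (\pi_(coker u) v) = \pi_(coker u) (a *: v).
Proof.
apply/eqP; rewrite /coker_scale coker_pi_eq -scalerBr.
have : repr (\pi_(coker u) v) - v \in range_pred u.
  by rewrite -coker_pi_eq coker_reprK.
case/range_predP => w <-.
by apply/range_predP; exists (a *: w); rewrite linearZ.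
Qed.

Lemma coker_piD u (v w : E) :
  \pi_(coker u) v + \pi_(coker u) w = \pi_(coker u) (v + w).
Proof. exact: (esym (Quotient.pi_add _ v w)). Qed.

Lemma coker_scaleA u a b (x : coker u) :
  coker_scale a (coker_scale b x) = coker_scale (a * b) x.
Proof. by rewrite -[x]coker_reprK !coker_pi_scale scalerA. Qed.

Lemma coker_scale1 u : left_id 1 (@coker_scale u).
Proof. by move=> x; rewrite -[x]coker_reprK coker_pi_scale scale1r. Qed.

Lemma coker_scaleDr u : right_distributive (@coker_scale u) +%R.
Proof.
move=> a x y; rewrite -[x]coker_reprK -[y]coker_reprK coker_piD !coker_pi_scale.
by rewrite coker_piD scalerDr.
Qed.

Lemma coker_scaleDl u (x : coker u) :
  {morph (@coker_scale u)^~ x : a b / a + b}.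
Proof.
by move=> a b; rewrite /= -[x]coker_reprK !coker_pi_scale coker_piD scalerDl.
Qed.

HB.instance Definition _ u :=
  GRing.Zmodule_isLmodule.Build K (coker u)
    (@coker_scaleA u) (@coker_scale1 u) (@coker_scaleDr u) (@coker_scaleDl u).

(* V is finite-dimensional of dimension n; in contrast with vectType, V may be
   any K-vector space. *)
Definition has_dim (V : lmodType K) (n : nat) : Prop :=
  inhabited (Vector.axiom n V).

Definition has_index u (chi : int) : Prop :=
  exists p q : nat,
    [/\ has_dim (ker u) p, has_dim (coker u) q & chi = p%:Z - q%:Z].

End Index.

(* K[x]^N as a vector space over K; the matrix type itself only carries the
   {poly K}-module structure. *)
Definition polycV (K : fieldType) (N : nat) := 'cV[{poly K}]_N.

Section PolyColumns.
Variables (K : fieldType) (N : nat).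

HB.instance Definition _ := GRing.Zmodule.on (polycV K N).

Definition polycV_scale (a : K) (v : polycV K N) : polycV K N :=
  map_mx (fun p => a *: p) v.

Lemma polycV_scaleA a b (v : polycV K N) :
  polycV_scale a (polycV_scale b v) = polycV_scale (a * b) v.
Proof. by apply/matrixP => i j; rewrite !mxE scalerA. Qed.

Lemma polycV_scale1 : left_id 1 polycV_scale.
Proof. by move=> v; apply/matrixP => i j; rewrite !mxE scale1r. Qed.

Lemma polycV_scaleDr : right_distributive polycV_scale +%R.
Proof. by move=> a v w; apply/matrixP => i j; rewrite !mxE scalerDr. Qed.

Lemma polycV_scaleDl v : {morph polycV_scale^~ v : a b / a + b}.
Proof. by move=> a b; apply/matrixP => i j; rewrite !mxE scalerDl. Qed.

HB.instance Definition _ :=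
  GRing.Zmodule_isLmodule.Build K (polycV K N)
    polycV_scaleA polycV_scale1 polycV_scaleDr polycV_scaleDl.

End PolyColumns.

Section DiffOperator.
Variables (K : fieldType) (N m : nat).
Implicit Type A : 'I_m.+1 -> 'M[{poly K}]_N.

Definition diffop A (f : polycV K N) : polycV K N :=
  \sum_(i < m.+1) A i *m map_mx (derivn i) f.

Lemma diffop_linear A : linear (diffop A).
Proof.
move=> a f g; apply/matrixP => r s; rewrite !mxE !summxE scaler_sumr -big_split /=.
apply: eq_bigr => i _; rewrite !mxE scaler_sumr -big_split /=.
apply: eq_bigr => j _; rewrite !mxE linearP /=.
by rewrite mulrDr scalerAr.
Qed.

HB.instance Definition _ A :=
  GRing.isLinear.Build K (polycV K N) (polycV K N) _ (diffop A) (diffop_linear A).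

End DiffOperator.

Section Exponents.
Variables (K : fieldType) (N : nat).
Implicit Type B : 'M[{poly K}]_N.

(* the constant matrix B^k in B(x) = \sum_k B^k x^k *)
Definition coefmx B (k : nat) : 'M[K]_N := map_mx (coefp k) B.

Definition edeg (p : {poly K}) : \bar int :=
  if p == 0 then -oo%E else (size p).-1%:Z%:E.

Definition mxdeg B : \bar int :=
  \big[Order.max/-oo%E]_(i < N) \big[Order.max/-oo%E]_(j < N) edeg (B i j).

(* the least k with B^k != 0, and +oo for B = 0 *)
Definition mxval B : \bar int :=
  if pselect (exists k, coefmx B k != 0) is left nzB
  then (ex_minn nzB)%:Z%:E else +oo%E.

(* B^e, meant for finite e >= 0 *)
Definition ecoefmx B (e : \bar int) : 'M[K]_N := coefmx B `|fine e|%N.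

(* k (k - 1) ... (k - j + 1) as a polynomial in k; below, the variable of the
   entries of Lmx and Dmx, and of lpoly and dpoly, is k rather than x. *)
Definition ffact_poly (j : nat) : {poly K} := \prod_(r < j) ('X - r%:R%:P).

End Exponents.

Section Indicial.
Variables (K : fieldType) (N m : nat) (A : 'I_m.+1 -> 'M[{poly K}]_N).

Local Notation "j %:EI" := ((j : nat)%:Z%:E) (at level 2).

Definition nsup : \bar int :=
  \big[Order.max/-oo%E]_(i < m.+1) (i%:EI - mxval (A i))%E.

Definition Jset : {set 'I_m.+1} :=
  [set j : 'I_m.+1 | (j%:EI - mxval (A j))%E == nsup].

Definition Lmx : 'M[{poly K}]_N :=
  \sum_(j in Jset) ffact_poly K j *: map_mx polyC (ecoefmx (A j) (mxval (A j))).

Definition lpoly : {poly K} := \det Lmx.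

Definition ninf : \bar int :=
  \big[Order.min/+oo%E]_(i < m.+1) (i%:EI - mxdeg (A i))%E.

Definition J'set : {set 'I_m.+1} :=
  [set j : 'I_m.+1 | (j%:EI - mxdeg (A j))%E == ninf].

Definition Dmx : 'M[{poly K}]_N :=
  \sum_(j in J'set) ffact_poly K j *: map_mx polyC (ecoefmx (A j) (mxdeg (A j))).

Definition dpoly : {poly K} := \det Dmx.

End Indicial.

(* Main.v *)
(* P maps x^s v to a vector polynomial of degree at most s - n' whose
   coefficient of degree s - n' is D(s) v.  As K has characteristic 0, d vanishes
   at finitely many integers only, so for k large D(s) is invertible for all
   s >= k.  Comparing top coefficients, P f of degree < k - n' forces f of degree
   < k, and every g is P f up to terms of degree < k - n'.  Hence P has the kernel
   and the cokernel of its restriction from degree < k to degree < k - n', a map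
   between spaces of dimensions N k and N (k - n'). *)
Require Import Defs.
From HB Require Import structures.
From mathcomp Require Import all_boot all_order all_algebra.
From mathcomp Require Import complex reals constructive_ereal.
From mathcomp Require Import generic_quotient ring_quotient boolp zify ring.
Set Implicit Arguments.
Unset Strict Implicit.
Unset Printing Implicit Defensive.
Import Order.TTheory GRing.Theory Num.Theory.
Local Open Scope ring_scope.
Local Open Scope quotient_scope.

(** * Reduction of an index to a finite matrix *)

Lemma has_dim_param (K : fieldType) (V : lmodType K) n
    (h : 'rV[K]_n -> V) :
  linear h -> injective h -> (forall v, exists w, h w = v) -> has_dim V n.
Proof.
move=> h_lin hI hS; have [g gK] := choice hS.
have hK : cancel h g by move=> w; apply: hI; rewrite gK.
constructor; exists g; last by exists h.
pose hM := GRing.isLinear.Build K _ V _ h h_lin.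
pose hL : {linear 'rV[K]_n -> V} := HB.pack h hM.
exact: (can2_linear (f := hL) hK gK).
Qed.

(** The hypotheses make [u] induce a matrix [M] from K^p to K^q, with kernel of [u] equal to the
    image under [phi] of the kernel of [M], and cokernel of [u] isomorphic to K^q modulo the row
    space of [M]; rank-nullity then gives p - q. *)
Lemma has_index_reduction (K : fieldType) (E : lmodType K)
    (u : {linear E -> E}) p q (phi : {linear 'rV[K]_p -> E})
    (psi : {linear 'rV[K]_q -> E}) :
    injective phi -> injective psi ->
    (forall v, exists w, u (phi v) = psi w) ->
    (forall f w, u f = psi w -> exists v, f = phi v) ->
    (forall g, exists f w, g = u f + psi w) ->
  has_index u (p%:Z - q%:Z).
Proof.
move=> phiI psiI /choice[uM uME] kerP cokerP.
have uM_lin : linear uM.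
  by move=> a v w; apply: psiI; rewrite -uME !linearP /= !uME.
pose uML : {linear 'rV[K]_p -> 'rV[K]_q} :=
  HB.pack uM (GRing.isLinear.Build K _ _ _ uM uM_lin).
pose M := lin1_mx uML.
have uphi v : u (phi v) = psi (v *m M) by rewrite mul_rV_lin1 uME.
(* The complement [M^C] of the row space of [M] models the cokernel. *)
exists (\rank (kermx M)), (\rank M^C%MS); split; last first.
- by rewrite mxrank_ker mxrank_compl; have := rank_leq_row M; have := rank_leq_col M; lia.
- have h_lin : linear (fun w : 'rV_(\rank M^C%MS) =>
      \pi_(coker u) (psi (w *m row_base M^C%MS)) : coker u).
    move=> a v w; rewrite mulmxDl -scalemxAl linearP -coker_piD; congr (_ + _).
    by rewrite -coker_pi_scale.
  apply: (has_dim_param h_lin) => [v w /eqP | x].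
    rewrite /= coker_pi_eq -linearB -mulmxBl => /range_predP[f uf].
    (* The preimage comes from [phi], so the difference lies in both [M] and [M^C] and vanishes. *)
    have [z fE] := kerP _ _ uf; rewrite fE uphi in uf.
    have /psiI zM := uf; apply/subr0_eq/eqP.
    rewrite -(mulmx_free_eq0 _ (row_base_free M^C%MS)) -submx0 -(capmx_compl M).
    by rewrite sub_capmx -{1}zM submxMl -(eq_row_base M^C%MS) submxMl.
  (* Modulo the range of [u] only the [M^C] part of [w] survives, since
     [psi (a *m M) = u (phi a)]. *)
  have [f [w xE]] := cokerP (repr x).
  have /sub_addsmxP[[a b] /= wE] : (w <= M + M^C)%MS.
    by rewrite submx_full // addsmx_compl_full.
  have /submxP[c bE] : (b *m M^C <= row_base M^C)%MS.
    by rewrite eq_row_base submxMl.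
  exists c; rewrite /= -bE -[x]coker_reprK.
  apply/eqP; rewrite coker_pi_eq xE wE [psi (_ + _)]linearD -uphi.
  apply/range_predP; exists (- f - phi a); rewrite linearB linearN.
  by rewrite addrA [_ + psi (b *m _)]addrC !opprD addNKr.
have h_ker (w : 'rV_(\rank (kermx M))) :
    phi (w *m row_base (kermx M)) \in ker_pred u.
  rewrite unfold_in uphi; have /submxP[c ->] : (w *m row_base (kermx M) <= kermx M)%MS.
    by rewrite -(eq_row_base (kermx M)) submxMl.
  by rewrite -mulmxA mulmx_ker mulmx0 linear0.
have h_lin : linear (fun w => Ker (h_ker w)).
  by move=> a v w; apply: val_inj; rewrite /= mulmxDl -scalemxAl linearP.
apply: (has_dim_param h_lin) => [v w /(congr1 val) /= /phiI vw | [f kf]].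
  apply/subr0_eq/eqP; rewrite -(mulmx_free_eq0 _ (row_base_free (kermx M))).
  by rewrite mulmxBl vw subrr.
(* Writing 0 as [psi 0] places the kernel inside the image of [phi]. *)
have uf0 : u f = psi 0 by rewrite linear0; apply/eqP.
have [v fE] := kerP _ _ uf0; rewrite fE uphi in uf0.
have /submxP[c vE] : (v <= row_base (kermx M))%MS.
  by rewrite eq_row_base; apply/sub_kermxP/psiI.
by exists c; apply: val_inj; rewrite /= -vE.
Qed.

(** * Coefficients of P f and the matrices D(s) *)

Section LeadingCoefficients.
Variables (K : fieldType) (N : nat).
Implicit Types (f g : polycV K N) (B : 'M[{poly K}]_N).

Definition coefcv (t : nat) f : 'cV[K]_N := map_mx (coefp t) f.

(** Stated by vanishing coefficients, so that k = 0 means f = 0 and no degree of the zero column is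
    needed. *)
Definition deg_lt (k : nat) f := forall j, (k <= j)%N -> coefcv j f = 0.

Lemma deg_lt_exists f : exists k, deg_lt k f.
Proof.
exists (\max_(i < N) size (f i ord0)) => j j_ge; apply/matrixP => r c.
rewrite !mxE /= nth_default // (ord1 c) (leq_trans _ j_ge) //.
exact: (leq_bigmax (F := fun i => size (f i ord0)) r).
Qed.

Lemma coefcvB t f g : coefcv t (f - g) = coefcv t f - coefcv t g.
Proof. by apply/matrixP => i j; rewrite !mxE -coefB; congr _`_t; rewrite mxE. Qed.

Definition monocv (t : nat) (v : 'cV[K]_N) : polycV K N :=
  map_mx (fun c => c *: 'X^t) v.

Lemma coefcv_monocv j t v : coefcv j (monocv t v) = if j == t then v else 0.
Proof.
apply/matrixP => r s; rewrite !mxE /= coefZ coefXn.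
by case: eqP; rewrite ?mulr1 ?mulr0 ?mxE.
Qed.

Lemma coefcv_mulmx t B f :
  coefcv t (B *m f : polycV K N) = \sum_(a < t.+1) coefmx B a *m coefcv (t - a) f.
Proof.
apply/matrixP => r s; rewrite !mxE /= coef_sum summxE.
under [RHS]eq_bigr do rewrite mxE.
rewrite exchange_big; apply: eq_bigr => i _.
by rewrite coefM; apply: eq_bigr => a _; rewrite !mxE.
Qed.

Lemma coefcv_derivn t i f :
  coefcv t (map_mx (derivn i) f : polycV K N) =
    ((i + t) ^_ i)%:R *: coefcv (i + t) f.
Proof. by apply/matrixP => r s; rewrite !mxE /= coef_derivn mulr_natl. Qed.

Lemma coefmx0 k : coefmx (0 : 'M[{poly K}]_N) k = 0.
Proof. by apply/matrixP => i j; rewrite !mxE /= coef0. Qed.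

Lemma coefcv_diffop m (A : 'I_m.+1 -> 'M[{poly K}]_N) t f :
  coefcv t (diffop A f) =
    \sum_(i < m.+1) \sum_(a < t.+1)
      ((i + (t - a)) ^_ i)%:R *: (coefmx (A i) a *m coefcv (i + (t - a)) f).
Proof.
rewrite /diffop; transitivity
    (\sum_(i < m.+1) coefcv t (A i *m map_mx (derivn i) f : polycV K N)).
  apply/matrixP => r s; rewrite mxE /= !summxE coef_sum.
  by apply: eq_bigr => i _; rewrite [RHS]mxE.
apply: eq_bigr => i _; rewrite coefcv_mulmx; apply: eq_bigr => a _.
by rewrite coefcv_derivn scalemxAr.
Qed.

(** Being -oo or a natural number is stable under max, and each entry degree is of this kind. *)
Lemma mxdeg_spec B :
  (mxdeg B = -oo%E /\ B = 0) \/
  exists2 d : nat, mxdeg B = d%:Z%:E & forall k, (d < k)%N -> coefmx B k = 0.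
Proof.
have edeg_le i j : (edeg (B i j) <= mxdeg B)%E.
  by apply: le_trans (le_bigmax _ _ i); apply: le_trans (le_bigmax _ _ j).
have [BE|[d dE]] : mxdeg B = -oo%E \/ exists d : nat, mxdeg B = d%:Z%:E.
- pose Q (x : \bar int) := x = -oo%E \/ exists d : nat, x = d%:Z%:E.
  have Qmax x y : Q x -> Q y -> Q (Order.max x y) by case: leP.
  apply: (big_ind Q) => [|//|i _]; first by left.
  apply: (big_ind Q) => [|//|j _]; first by left.
  by rewrite /edeg; case: ifP => _; [left | right; eexists].
- left; split=> //; apply/matrixP => i j; rewrite mxE; apply/eqP.
  by have := edeg_le i j; rewrite BE leeNy_eq /edeg; case: ifP.
right; exists d => // k dk; apply/matrixP => i j; rewrite !mxE /=.
have := edeg_le i j; rewrite dE /edeg; case: eqP => [-> _|/eqP Bij]; first by rewrite coef0.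
rewrite lee_fin lez_nat => Bd; rewrite nth_default // (leq_trans (leqSpred _)) //.
exact: leq_ltn_trans dk.
Qed.

(** Each i - deg A_i is +oo or an integer, hence so is the minimum; the finite term at [i0] excludes
    +oo. *)
Lemma ninf_fin_num m (A : 'I_m.+1 -> 'M[{poly K}]_N) i0 :
  A i0 != 0 -> exists n : int, ninf A = n%:E.
Proof.
move=> Ai0.
have term (i : 'I_m.+1) :
    ((i : nat)%:Z%:E - mxdeg (A i))%E = +oo%E /\ A i = 0 \/
    exists n : int, ((i : nat)%:Z%:E - mxdeg (A i))%E = n%:E.
  have [[-> ->]|[d -> _]] := mxdeg_spec (A i); first by left.
  by right; exists (i%:Z - d%:Z).
have [nE|//] : ninf A = +oo%E \/ exists n : int, ninf A = n%:E.
  pose Q (x : \bar int) := x = +oo%E \/ exists n : int, x = n%:E.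
  apply: (big_ind Q) => [|x y|i _]; [by left | by case: leP | ].
  by have [[-> _]|//] := term i; [left | right].
have : (ninf A <= (i0 : nat)%:Z%:E - mxdeg (A i0))%E by exact: bigmin_le.
have [[_ /eqP]|[n ->]] := term i0; first by rewrite (negPf Ai0).
by rewrite nE leye_eq.
Qed.

(* the value D(s) at the integer s, as a matrix over K *)
Definition Dval m (A : 'I_m.+1 -> 'M[{poly K}]_N) (s : nat) : 'M[K]_N :=
  \sum_(j in J'set A) (s ^_ j)%:R *: ecoefmx (A j) (mxdeg (A j)).

(* For j in J' with deg A_j > t, the top coefficient of A_j does not enter the
   coefficient t of P f; it does not enter D(s) either, as s < j gives s^_j = 0. *)
Lemma coefcv_diffop_top m (A : 'I_m.+1 -> 'M[{poly K}]_N) (n : int) s t f :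
    ninf A = n%:E -> s%:Z = t%:Z + n -> deg_lt s.+1 f ->
  coefcv t (diffop A f) = Dval A s *m coefcv s f.
Proof.
move=> nE stn fs; rewrite coefcv_diffop /Dval mulmx_suml [RHS]big_mkcond.
apply: eq_bigr => i _; rewrite inE nE.
have : (ninf A <= (i : nat)%:Z%:E - mxdeg (A i))%E by exact: bigmin_le.
rewrite nE.
have [[AE A0]|[d dE dA]] := mxdeg_spec (A i); rewrite /ecoefmx.
  move=> _; rewrite AE A0 /= big1 // => a _.
  by rewrite coefmx0 mul0mx scaler0.
rewrite dE /= lee_fin eqe => n_le; case: eqP => [nd | n_ne].
  have [dt|td] := leqP d t; last first.
    rewrite ffact_small; last by lia.
    rewrite scale0r mul0mx big1 // => a _; rewrite fs ?mulmx0 ?scaler0 //; have := ltn_ord a; lia.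
  (* Only a = d contributes: the coefficient of A_i vanishes for a > d, and for a < d the index i +
     t - a exceeds s. *)
  rewrite (bigD1 (Ordinal (dt : (d < t.+1)%N))) //= big1 => [|a].
    by rewrite addr0 (_ : i + (t - d) = s)%N ?scalemxAl //; lia.
  rewrite -val_eqE /= => ad; have [da|da] := ltnP d a; first by rewrite dA // mul0mx scaler0.
  rewrite fs ?mulmx0 ?scaler0 //; have := ltn_ord a; lia.
(* Outside J', i - d > n, so a <= d gives i + t - a > s. *)
rewrite big1 // => a _; have [da|da] := ltnP d a; first by rewrite dA // mul0mx scaler0.
rewrite fs ?mulmx0 ?scaler0 //; have := ltn_ord a; lia.
Qed.

Lemma horner_ffact_poly j s : (ffact_poly K j).[s%:R] = (s ^_ j)%:R.
Proof.
rewrite /ffact_poly; elim: j => [|j IHj]; first by rewrite big_ord0 hornerC.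
rewrite big_ord_recr hornerM IHj hornerXsubC ffactnSr natrM.
(* Truncated subtraction s - j is harmless: for j > s the other factor is 0. *)
have [js|sj] := leqP j s; first by rewrite natrB.
by rewrite ffact_small // !mul0r.
Qed.

Lemma horner_dpoly m (A : 'I_m.+1 -> 'M[{poly K}]_N) s :
  (dpoly A).[s%:R] = \det (Dval A s).
Proof.
rewrite -horner_evalE -det_map_mx; congr (\det _).
apply/matrixP => r c; rewrite mxE /= /horner_eval /Dmx /Dval !summxE horner_sum.
by apply: eq_bigr => j _; rewrite !mxE hornerM horner_ffact_poly hornerC.
Qed.

End LeadingCoefficients.

(** Induction on the size, splitting off a natural root [s0]; in characteristic 0 the factor X - s0
    is nonzero at every s > s0. *)
Lemma eventually_horner_neq0 (K : numFieldType) (p : {poly K}) :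
  p != 0 -> exists k0, forall s, (k0 <= s)%N -> p.[s%:R] != 0.
Proof.
have [n] := ubnP (size p); elim: n p => // n IHn p pn p0.
have [[s0 ps0]|noroot] := pselect (exists s : nat, root p s%:R); last first.
  by exists 0%N => s _; apply/negP => ps; apply: noroot; exists s.
have /factor_theorem[q pE] := ps0.
have q0 : q != 0 by apply: contra_neq p0 => q0; rewrite pE q0 mul0r.
have [|k0 qk] := IHn q _ q0.
  by move: pn; rewrite pE size_Mmonic ?monicXsubC // size_XsubC addn2.
exists (maxn k0 s0.+1) => s; rewrite geq_max => /andP[ks ss].
by rewrite pE hornerM hornerXsubC mulf_neq0 ?qk // subr_eq0 eqr_nat gtn_eqF.
Qed.

(** * Columns of degree below k *)

Section Truncation.
Variables (K : fieldType) (N k : nat).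

(** Coordinates showing that the columns of degree below k form a space of dimension N k. *)
Definition polycV_of_row (v : 'rV[K]_(N * k)) : polycV K N :=
  \col_i rVpoly (row i (vec_mx v)).

Lemma polycV_of_row_linear : linear polycV_of_row.
Proof.
by move=> a v w; apply/matrixP => i j; rewrite !mxE linearP linearP linearP.
Qed.

HB.instance Definition _ :=
  GRing.isLinear.Build K _ (polycV K N) _ polycV_of_row polycV_of_row_linear.

Lemma deg_lt_size (f : polycV K N) i j : deg_lt k f -> (size (f i j) <= k)%N.
Proof.
by move=> fk; apply/leq_sizeP => t /fk/matrixP/(_ i j); rewrite !mxE.
Qed.

Lemma deg_lt_polycV_of_row v : deg_lt k (polycV_of_row v).
Proof.
move=> t kt; apply/matrixP => i j; rewrite !mxE /= nth_default //.
exact: leq_trans (size_poly _ _) kt.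
Qed.

Lemma polycV_of_row_inj : injective polycV_of_row.
Proof.
move=> v w vw; apply: (can_inj vec_mxK); apply/row_matrixP => i.
by apply: (can_inj rVpolyK); have /matrixP/(_ i 0) := vw; rewrite !mxE.
Qed.

Lemma polycV_of_row_surj f : deg_lt k f -> exists v, f = polycV_of_row v.
Proof.
move=> fk; exists (mxvec (\matrix_i poly_rV (f i 0))).
apply/matrixP => i j; rewrite !mxE mxvecK rowK poly_rV_K ?(ord1 j) //.
exact: deg_lt_size.
Qed.

End Truncation.

(** * Comparison of P with its truncation *)

Section Index.
Variables (K : fieldType) (N m : nat) (A : 'I_m.+1 -> 'M[{poly K}]_N).
Variables (n : int) (k k' : nat).
Hypotheses (ninfA : ninf A = n%:E) (kk' : k%:Z = k'%:Z + n).
Hypothesis Dval_unit : forall s, (k <= s)%N -> Dval A s \in unitmx.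

Lemma deg_lt_diffop f : deg_lt k f -> deg_lt k' (diffop A f).
Proof.
(* From t >= k' follows t + n >= k >= 0, so the absolute value changes nothing. *)
move=> fk t kt; have tn : (absz (t%:Z + n))%:Z = t%:Z + n by lia.
by rewrite (coefcv_diffop_top ninfA tn) ?fk ?mulmx0 // => [|j j_ge]; [lia | apply: fk; lia].
Qed.

(** Descent from any degree bound d + k: the coefficient d + k of f is killed by the invertible D(d
    + k), so the bound drops by one. *)
Lemma deg_lt_of_diffop f : deg_lt k' (diffop A f) -> deg_lt k f.
Proof.
move=> Pf; suff [d fd] : exists d, deg_lt (d + k) f.
  elim: d fd => // d IHd fd; apply: IHd => j j_ge.
  have [->|jn] := eqVneq j (d + k)%N; last by apply: fd; lia.
  have tn : (d + k)%N%:Z = (d + k')%N%:Z + n by lia.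
  have := coefcv_diffop_top ninfA tn fd; rewrite Pf ?leq_addl // => /esym eq0.
  by rewrite -[LHS](mulKmx (Dval_unit (leq_addl d k))) eq0 mulmx0.
have [d fd] := deg_lt_exists f; exists d => j j_ge; apply: fd; lia.
Qed.

Lemma diffop_approx g : exists f, deg_lt k' (g - diffop A f).
Proof.
suff approx d h : deg_lt (d + k') h -> exists f, deg_lt k' (h - diffop A f).
  have [d gd] := deg_lt_exists g; apply: (approx d) => j j_ge; apply: gd; lia.
elim: d h => [|d IHd] h hd; first by exists 0; rewrite linear0 subr0.
(* With this monomial, P f has the same coefficient of degree d + k' as h. *)
pose f := monocv (d + k) (invmx (Dval A (d + k)) *m coefcv (d + k') h).
have fd : deg_lt (d + k).+1 f.
  by move=> j j_gt; rewrite coefcv_monocv gtn_eqF.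
have [|f' f'P] := IHd (h - diffop A f).
  move=> j j_ge; rewrite coefcvB; have [->|jn] := eqVneq j (d + k')%N.
    have tn : (d + k)%N%:Z = (d + k')%N%:Z + n by lia.
    rewrite (coefcv_diffop_top ninfA tn fd) coefcv_monocv eqxx.
    by rewrite mulKVmx ?subrr // Dval_unit ?leq_addl.
  (* Above degree d + k' both h and P f vanish, as j + n > d + k. *)
  have tn : (absz (j%:Z + n))%:Z = j%:Z + n by lia.
  rewrite hd ?(coefcv_diffop_top ninfA tn) ?coefcv_monocv; try by lia.
    by rewrite ifF ?mulmx0 ?subrr //; lia.
  by move=> i i_gt; rewrite coefcv_monocv ifF //; lia.
exists (f + f'); rewrite linearD opprD addrA; exact: f'P.
Qed.

Lemma has_index_diffop : has_index (diffop A) (N%:Z * n).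
Proof.
have -> : N%:Z * n = (N * k)%N%:Z - (N * k')%N%:Z by rewrite !PoszM kk'; ring.
apply: (@has_index_reduction _ _ _ _ _ (@polycV_of_row K N k)
  (@polycV_of_row K N k')).
- exact: polycV_of_row_inj.
- exact: polycV_of_row_inj.
- by move=> v; apply/polycV_of_row_surj/deg_lt_diffop/deg_lt_polycV_of_row.
- move=> f w fw; apply/polycV_of_row_surj/deg_lt_of_diffop.
  by rewrite fw; apply: deg_lt_polycV_of_row.
move=> g; have [f /polycV_of_row_surj[w fw]] := diffop_approx g.
by exists f, w; apply/eqP; rewrite addrC -subr_eq; apply/eqP/fw.
Qed.

End Index.

Theorem mainTheorem2 (R : realType) (N m : nat)
    (A : 'I_m.+1 -> 'M[{poly R[i]}]_N) :
  \det (A ord_max) != 0 ->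
  lpoly A != 0 ->
  dpoly A != 0 ->
  exists2 chi : int,
    has_index (diffop A) chi &
    (chi%:E = N%:Z%:E * \big[Order.min/+oo]_(i < m.+1) ((i : nat)%:Z%:E - mxdeg (A i)))%E.
Proof.
case: N A => [|N'] A detAm _ d0.
  (* Here n' = +oo, and 0 * +oo = 0 in \bar int. *)
  have E0 (f : polycV R[i] 0) : f = 0 by apply/matrixP => -[].
  (* The index 0 is written as N k - N k' with all three equal to 0, to fit the reduction. *)
  exists ((0 * 0)%N%:Z - (0 * 0)%N%:Z); last by rewrite subrr mul0e.
  apply: (@has_index_reduction _ _ _ _ _ (@polycV_of_row R[i] 0 0)
    (@polycV_of_row R[i] 0 0)); first [exact: polycV_of_row_inj | move=> v].
  - by exists 0; rewrite [LHS]E0 [RHS]E0.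
  - by exists 0; rewrite [LHS]E0 [RHS]E0.
  - by exists 0, 0; rewrite [LHS]E0 [RHS]E0.
(* In positive size, a nonzero determinant forces A_m to be nonzero, so n' is finite. *)
have [|n nE] := @ninf_fin_num _ _ _ A ord_max.
  by apply: contra_neq detAm => ->; apply: det0.
have [k0 k0P] := eventually_horner_neq0 d0.
exists (N'.+1%:Z * n); last by rewrite -/(ninf A) nE.
(* Adding |n| to [k0] makes k - n a natural number while D(s) stays invertible for s >= k. *)
pose k := (k0 + `|n|)%N.
apply: (@has_index_diffop _ _ _ _ n k (absz (k%:Z - n))) => // [|s ks].
  by rewrite /k; lia.
by rewrite unitmxE unitfE -horner_dpoly k0P //; move: ks; rewrite /k; lia.
Qed.
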